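(* Let $X\subset \mathbb{R}^2$ be a finite set with $|X|\geq 4$, equipped with the restriction of the Manhattan metric $d_1$. Let $R_X$ denote the minimal rectangle in $\mathbb{R}^2$ with edges parallel to the axes that contains $X$. Then $X$ is trim if and only if each edge of $R_X$ contains at least two points of $X$.
   Context: The Manhattan metric on $\mathbb{R}^2$ is $d_1((x_1,y_1),(x_2,y_2))=|x_1-x_2|+|y_1-y_2|$. For a finite metric space $(X,d)$ with $|X|\ge 3$ and $x\in X$, the pendant length of $x$ is $$\underline{d}(x)=\min_{\substack{y,z\in X\setminus\{x\}\\ y\neq z}} \frac{d(x,y)+d(x,z)-d(y,z)}{2}.$$ The space $(X,d)$ is called trim (or pendant-free) if $\underline{d}(x)=0$ for all $x\in X$. The minimal rectangle is $R_X=[x_{\min},x_{\max}]\times[y_{\min},y_{\max}]$, where $x_{\min},x_{\max}$ (resp. $y_{\min},y_{\max}$) are the smallest and largest abscissas (resp. ordinates) of points of $X$. Its four edges are the closed segments $\{x_{\min}\}\times[y_{\min},y_{\max}]$, $\{x_{\max}\}\times[y_{\min},y_{\max}]$, $[x_{\min},x_{\max}]\times\{y_{\min}\}$ and $[x_{\min},x_{\max}]\times\{y_{\max}\}$; a corner belongs to both edges meeting there. *)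

(* Defs.v *)
From HB Require Import structures.
From mathcomp Require Import all_boot all_order all_algebra finmap.
From mathcomp Require Import boolp classical_sets set_interval reals.
From mathcomp Require Import topology.
From mathcomp Require Import lra.

Set Implicit Arguments.
Unset Strict Implicit.
Unset Printing Implicit Defensive.

Import Order.TTheory GRing.Theory Num.Theory.

Local Open Scope classical_set_scope.
Local Open Scope ring_scope.

Section FiniteMinMax.
Context {R : realType}.
Implicit Types (s : seq R) (a : R).

(* Seeding the iteration with the head makes these the minimum and maximum of
   every nonempty list; both are 0 on the empty list. *)
Definition seqmin s : R := \big[Num.min/head 0 s]_(a <- s) a.
Definition seqmax s : R := \big[Num.max/head 0 s]_(a <- s) a.

Lemma seqmin_le s a : a \in s -> seqmin s <= a.
Proof. by move=> sa; apply: (bigmin_inf_seq _ a). Qed.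

Lemma seqmax_ge s a : a \in s -> a <= seqmax s.
Proof. by move=> sa; apply: (le_bigmax_seq _ a). Qed.

Lemma seqmin_mem s : s != [::] -> seqmin s \in s.
Proof.
case: s => // b s _; rewrite /seqmin big_seq.
elim/big_ind: _ => [|x y xs ys|//]; first exact: mem_head.
by rewrite /Num.min; case: ifP.
Qed.

Lemma seqmax_mem s : s != [::] -> seqmax s \in s.
Proof.
case: s => // b s _; rewrite /seqmax big_seq.
elim/big_ind: _ => [|x y xs ys|//]; first exact: mem_head.
by rewrite /Num.max; case: ifP.
Qed.

End FiniteMinMax.

Section Trim.
Context {R : realType} {M : metricType R}.
Implicit Types (X : {fset M}) (x : M).

(* A finite metric space is a finite subset X of a metric space, with the
   restricted distance. The pendant length is meaningful when X has at least
   three points and x is one of them. *)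
Definition pendant_length X x : R :=
  seqmin [seq (mdist x y + mdist x z - mdist y z) / 2
         | y <- (X `\ x)%fset, z <- (X `\ x `\ y)%fset].

Definition trim X : Prop := forall x, x \in X -> pendant_length X x = 0.

End Trim.

(* An alias of R * R, whose library metric would be the maximum metric. *)
Definition manhattan (R : realType) : Type := (R * R)%type.

Section Manhattan.
Context {R : realType}.
Implicit Types p q r : manhattan R.

HB.instance Definition _ := Choice.on (manhattan R).

Definition d1 p q : R := `|p.1 - q.1| + `|p.2 - q.2|.

Let d1xx p : d1 p p = 0.
Proof. by rewrite /d1 !subrr normr0 addr0. Qed.

Let d1_positivity p q : d1 p q = 0 -> p = q.
Proof.
move=> /eqP; rewrite /d1 paddr_eq0// !normr_eq0 !subr_eq0.
by case: p q => [? ?] [? ?] /= /andP[/eqP-> /eqP->].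
Qed.

Let d1_sym p q : d1 p q = d1 q p.
Proof. by rewrite /d1 distrC [X in _ + X]distrC. Qed.

Let d1_triangle q p r : d1 p r <= d1 p q + d1 q r.
Proof.
by rewrite /d1 addrACA lerD// ler_distD.
Qed.

HB.instance Definition _ :=
  isMetric.Build R (manhattan R) d1xx d1_positivity d1_sym d1_triangle.

Lemma mdistE p q : mdist p q = `|p.1 - q.1| + `|p.2 - q.2|.
Proof. by []. Qed.

End Manhattan.

(* The rectangle [x_lo, x_hi] x [y_lo, y_hi], possibly degenerate. *)
Record rectangle (R : realType) :=
  Rectangle { x_lo : R; x_hi : R; y_lo : R; y_hi : R }.

Section Rectangle.
Context {R : realType}.
Implicit Types (Q : rectangle R) (X : {fset manhattan R}).

Definition rect_set Q : set (manhattan R) :=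
  `[x_lo Q, x_hi Q] `*` `[y_lo Q, y_hi Q].

Definition edges Q : set (set (manhattan R)) :=
  [set [set x_lo Q] `*` `[y_lo Q, y_hi Q];
       [set x_hi Q] `*` `[y_lo Q, y_hi Q];
       `[x_lo Q, x_hi Q] `*` [set y_lo Q];
       `[x_lo Q, x_hi Q] `*` [set y_hi Q]].

Definition min_rectangle X : rectangle R :=
  Rectangle (seqmin [seq p.1 | p <- X]) (seqmax [seq p.1 | p <- X])
            (seqmin [seq p.2 | p <- X]) (seqmax [seq p.2 | p <- X]).

Lemma sub_min_rectangle X : [set` X] `<=` rect_set (min_rectangle X).
Proof.
by move=> p pX; split; rewrite /= in_itv /= seqmin_le ?seqmax_ge ?map_f.
Qed.

Lemma min_rectangle_least X Q : X != fset0%fset ->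
  [set` X] `<=` rect_set Q -> rect_set (min_rectangle X) `<=` rect_set Q.
Proof.
move=> X0 XQ p [] /=; rewrite !in_itv /= => /andP[p1l p1h] /andP[p2l p2h].
have mapX0 (f : manhattan R -> R) : [seq f q | q <- X] != [::].
  by case/fset0Pn: X0 => q qX; apply/eqP => fX0; move: (map_f f qX); rewrite fX0.
have /mapP[a aX ae] := seqmin_mem (mapX0 fst).
have /mapP[b bX be] := seqmax_mem (mapX0 fst).
have /mapP[c cX ce] := seqmin_mem (mapX0 snd).
have /mapP[d dX de] := seqmax_mem (mapX0 snd).
have [] := (XQ _ aX, XQ _ bX); rewrite /rect_set /= !in_itv /=.
move=> [/andP[al _] _] [/andP[_ bh] _].
have [] := (XQ _ cX, XQ _ dX); rewrite /rect_set /= !in_itv /=.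
move=> [_ /andP[cl _]] [_ /andP[_ dh]].
by split; apply/andP; split; lra.
Qed.

End Rectangle.

(* Main.v *)
Require Import Defs.
From mathcomp Require Import all_boot all_order all_algebra finmap.
From mathcomp Require Import boolp classical_sets reals topology.
From mathcomp Require Import lra.

(** The pendant length of [x] is a minimum of nonnegative numbers, so it
vanishes exactly when [x] lies metrically between two other distinct points
[y] and [z] of the space ([trimP]).  For the Manhattan metric this says that
[x] lies in the box with opposite corners [y] and [z], hence that [y] and [z]
lie in opposite closed quadrants at [x].

If no two opposite closed quadrants at [x] both contain a point of [X] other
than [x], then two adjacent quadrants contain none, and so neither does the
closed half-plane that they form.  Conversely each of the four closed
half-planes with [x] on its boundary line contains [y] or [z] whenever [x] lies
in their box.  So [X] is trim if and only if, for every [x] in [X], each of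
these half-planes contains another point of [X] ([between_halfplanesP]).

Finally, fix one of the four directions.  A point of [X] whose half-plane in
that direction contains no other point of [X] is a strict maximum of [X] in
that direction, which means that it is the only point of [X] on the
corresponding edge of the minimal rectangle ([two_maximizersP]). *)

Import Order.TTheory GRing.Theory Num.Theory.

Local Open Scope fset_scope.
Local Open Scope ring_scope.

Lemma seqmin_eq0 {R : realType} (s : seq R) :
  s != [::] -> (forall a, a \in s -> 0 <= a) -> seqmin s = 0 <-> 0 \in s.
Proof.
move=> s0 s_ge0; split=> [<-|s_0]; first exact: seqmin_mem.
by apply/eqP; rewrite eq_le seqmin_le// s_ge0// seqmin_mem.
Qed.

(** The terms of the minimum are nonnegative by the triangle inequality; three
points are needed for there to be any term at all. *)
Lemma trimP {R : realType} {M : metricType R} (X : {fset M}) :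
  (3 <= #|` X|)%N ->
  trim X <-> (forall x, x \in X -> exists y z,
    [/\ y \in X `\ x, z \in X `\ x, z != y &
        mdist x y + mdist x z = mdist y z]).
Proof.
move=> X3; rewrite /trim /pendant_length.
suff pendant0P x : x \in X ->
    seqmin [seq (mdist x y + mdist x z - mdist y z) / 2
           | y <- X `\ x, z <- X `\ x `\ y] = 0 <->
    exists y z, [/\ y \in X `\ x, z \in X `\ x, z != y &
                    mdist x y + mdist x z = mdist y z].
  by split=> Xtrim x xX; apply/pendant0P => //; exact: Xtrim.
move=> xX.
have Xx2 : (2 <= #|` X `\ x|)%N by rewrite (cardfsD1 x) xX in X3.
rewrite seqmin_eq0.
- split.
    case/allpairsPdep => y [z [yXx]]; rewrite in_fsetD1 => /andP[zy zXx] e0.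
    by exists y, z; split=> //; lra.
  case=> y [z [yXx zXx zy xyz]]; apply/allpairsPdep; exists y, z; split=> //.
    by rewrite in_fsetD1 zy.
  by rewrite xyz subrr mul0r.
- have /fset0Pn[y yXx] : X `\ x != fset0 by rewrite -cardfs_gt0 ltnW.
  have /fset0Pn[z zXxy] : X `\ x `\ y != fset0.
    by rewrite -cardfs_gt0; rewrite (cardfsD1 y) yXx in Xx2.
  suff: (mdist x y + mdist x z - mdist y z) / 2 \in
      [seq (mdist x y + mdist x z - mdist y z) / 2
      | y <- X `\ x, z <- X `\ x `\ y] by case: [seq _ | _ <- _, _ <- _].
  by apply/allpairsPdep; exists y, z.
- move=> _ /allpairsPdep[y [z [_ _ ->]]].
  by rewrite divr_ge0// subr_ge0 (metric_sym x y) metric_triangle.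
Qed.

Lemma dist_betweenP {R : realDomainType} (a b c : R) :
  reflect (`|a - b| + `|a - c| = `|b - c|) ((b <= a <= c) || (c <= a <= b)).
Proof.
by apply: (iffP idP); case: (ger0P (a - b)) => ?; case: (ger0P (a - c)) => ?;
  case: (ger0P (b - c)) => ?; lra.
Qed.

(** A sum of two triangle inequalities is an equality only if both are. *)
Lemma manhattan_betweenP {R : realType} (p q r : manhattan R) :
  mdist p q + mdist p r = mdist q r <->
  ((q.1 <= p.1 <= r.1) || (r.1 <= p.1 <= q.1)) /\
  ((q.2 <= p.2 <= r.2) || (r.2 <= p.2 <= q.2)).
Proof.
rewrite !mdistE; split=> [e|[/dist_betweenP e1 /dist_betweenP e2]]; last lra.
have := ler_distD p.1 q.1 r.1; have := ler_distD p.2 q.2 r.2.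
rewrite (distrC q.1 p.1) (distrC q.2 p.2) => t2 t1.
by split; apply/dist_betweenP; lra.
Qed.

(** Points [y] and [z] in opposite closed quadrants at [p] are automatically
distinct, because these quadrants meet only at [p]. *)
Lemma between_halfplanesP {R : realType} (X : {fset manhattan R})
    (p : manhattan R) :
  (exists y z, [/\ y \in X `\ p, z \in X `\ p, z != y &
                   mdist p y + mdist p z = mdist y z]) <->
  [/\ exists2 q, q \in X `\ p & q.1 <= p.1,
      exists2 q, q \in X `\ p & p.1 <= q.1,
      exists2 q, q \in X `\ p & q.2 <= p.2 &
      exists2 q, q \in X `\ p & p.2 <= q.2].
Proof.
split.
  case=> y [z [yX zX _ /manhattan_betweenP[]]].
  by move=> /orP[] /andP[? ?] /orP[] /andP[? ?];
    split; solve [by exists y | by exists z].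
have opposite y z : y \in X `\ p -> z \in X `\ p ->
    ((y.1 <= p.1 <= z.1) || (z.1 <= p.1 <= y.1)) ->
    ((y.2 <= p.2 <= z.2) || (z.2 <= p.2 <= y.2)) ->
    exists y z, [/\ y \in X `\ p, z \in X `\ p, z != y &
                    mdist p y + mdist p z = mdist y z].
  move=> yX zX b1 b2; exists y, z; split=> //; last exact/manhattan_betweenP.
  apply/eqP => zy; move: yX b1 b2; rewrite zy in_fsetD1 !orbb.
  move=> /andP[/eqP + _] /le_anti e1 /le_anti e2.
  by apply; case: (p) (y) e1 e2 => [? ?] [? ?] /= -> ->.
case=> -[w wX w1] [e eX e1] [s sX s2] [n nX n2].
(* When [w] and [e] are not already in opposite quadrants, they lie on the same
   side of the horizontal line through [p]; a point on the other side is then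
   opposite to [w] or to [e]. *)
case: (leP w.2 p.2) => [w2|/ltW w2]; case: (leP e.2 p.2) => [e2|/ltW e2].
- case: (leP n.1 p.1) => [n1|/ltW n1].
    by apply: (opposite n e); rewrite // ?n1 ?n2 ?e1 ?e2 ?orbT.
  by apply: (opposite w n); rewrite // ?n1 ?n2 ?w1 ?w2 ?orbT.
- by apply: (opposite w e); rewrite // ?e1 ?e2 ?w1 ?w2 ?orbT.
- by apply: (opposite w e); rewrite // ?e1 ?e2 ?w1 ?w2 ?orbT.
- case: (leP s.1 p.1) => [s1|/ltW s1].
    by apply: (opposite s e); rewrite // ?s1 ?s2 ?e1 ?e2 ?orbT.
  by apply: (opposite w s); rewrite // ?s1 ?s2 ?w1 ?w2 ?orbT.
Qed.

(** If no point is a strict maximum of [f] on [X], then some point other than a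
given maximizer has at least its value, and so is a second maximizer. *)
Lemma two_maximizersP {R : realDomainType} {T : choiceType} (X : {fset T})
    (E : pred T) (f : T -> R) (c : R) :
  (forall p, p \in X -> E p = (f p == c)) ->
  (forall p, p \in X -> f p <= c) -> (exists2 p, p \in X & f p = c) ->
  (2 <= #|` [fset p in X | E p]|)%N <->
  (forall p, p \in X -> exists2 q, q \in X `\ p & f p <= f q).
Proof.
move=> Efc f_le [m mX fm]; split=> [E2 p pX|X_max].
  have /fset0Pn[q] : [fset p in X | E p] `\ p != fset0.
    rewrite -cardfs_gt0; move: E2; rewrite (cardfsD1 p).
    by case: (_ \in _) => // /ltnW.
  rewrite !inE /= => /and3P[qp qX Eq]; exists q; first by rewrite in_fsetD1 qp.
  by move: Eq; rewrite Efc// => /eqP ->; exact: f_le.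
have [q] := X_max m mX; rewrite in_fsetD1 fm => /andP[qm qX] cq.
have fq : f q = c by apply/eqP; rewrite eq_le f_le.
have <- : #|` [fset q; m]| = 2%N by rewrite cardfs2 qm.
apply/fsubset_leq_card/fsubsetP => r.
by rewrite !inE => /orP[] /eqP ->; rewrite ?qX ?mX Efc// ?fq ?fm eqxx.
Qed.

Lemma two_minimizersP {R : realDomainType} {T : choiceType} (X : {fset T})
    (E : pred T) (f : T -> R) (c : R) :
  (forall p, p \in X -> E p = (f p == c)) ->
  (forall p, p \in X -> c <= f p) -> (exists2 p, p \in X & f p = c) ->
  (2 <= #|` [fset p in X | E p]|)%N <->
  (forall p, p \in X -> exists2 q, q \in X `\ p & f q <= f p).
Proof.
move=> Efc f_ge [m mX fm].
have oppP : (2 <= #|` [fset p in X | E p]|)%N <->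
    (forall p, p \in X -> exists2 q, q \in X `\ p & - f p <= - f q).
  apply: (two_maximizersP X E _ (- c)) => [p pX|p pX|].
  - by rewrite Efc// eqr_opp.
  - by rewrite lerN2 f_ge.
  - by exists m; rewrite // fm.
by rewrite oppP; split=> X_min p /X_min[q qX fqp]; exists q;
  rewrite // lerN2 in fqp *.
Qed.

Theorem proposition1 (R : realType) (X : {fset manhattan R})
    (cardX : (4 <= #|` X|)%N) :
  trim X <->
  (forall E : set (manhattan R), edges (min_rectangle X) E ->
    (2 <= #|` [fset p in X | p \in E]|)%N).
Proof.
rewrite trimP; last exact: ltnW.
have X0 : X != fset0 by rewrite -cardfs_gt0; exact: leq_trans cardX.
have mapX0 (f : manhattan R -> R) : [seq f q | q <- X] != [::].
  by rewrite -size_eq0 size_map -lt0n cardfs_gt0.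
have min_in (f : manhattan R -> R) :
    exists2 p, p \in X & f p = seqmin [seq f q | q <- X].
  by have /mapP[p pX ->] := seqmin_mem (mapX0 f); exists p.
have max_in (f : manhattan R -> R) :
    exists2 p, p \in X & f p = seqmax [seq f q | q <- X].
  by have /mapP[p pX ->] := seqmax_mem (mapX0 f); exists p.
set Q := min_rectangle X.
have inQ p : p \in X ->
    [/\ x_lo Q <= p.1, p.1 <= x_hi Q, y_lo Q <= p.2 & p.2 <= y_hi Q].
  move=> /(@sub_min_rectangle _ X p)[] /=; rewrite !in_itv.
  by move=> /andP[? ?] /andP[? ?].
have west : (2 <= #|` [fset p in X | p \in
    ([set x_lo Q] `*` `[y_lo Q, y_hi Q])%classic]|)%N <->
    (forall p, p \in X -> exists2 q, q \in X `\ p & q.1 <= p.1).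
  apply: (two_minimizersP X _ fst (x_lo Q))
    => [p pX|p /inQ[]//|]; last exact: min_in.
  have [? ? ? ?] := inQ p pX; apply/idP/eqP => [/set_mem[]//|pc].
  by apply/mem_set; split; rewrite //= in_itv /=; apply/andP.
have east : (2 <= #|` [fset p in X | p \in
    ([set x_hi Q] `*` `[y_lo Q, y_hi Q])%classic]|)%N <->
    (forall p, p \in X -> exists2 q, q \in X `\ p & p.1 <= q.1).
  apply: (two_maximizersP X _ fst (x_hi Q))
    => [p pX|p /inQ[]//|]; last exact: max_in.
  have [? ? ? ?] := inQ p pX; apply/idP/eqP => [/set_mem[]//|pc].
  by apply/mem_set; split; rewrite //= in_itv /=; apply/andP.
have south : (2 <= #|` [fset p in X | p \in
    (`[x_lo Q, x_hi Q] `*` [set y_lo Q])%classic]|)%N <->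
    (forall p, p \in X -> exists2 q, q \in X `\ p & q.2 <= p.2).
  apply: (two_minimizersP X _ snd (y_lo Q))
    => [p pX|p /inQ[]//|]; last exact: min_in.
  have [? ? ? ?] := inQ p pX; apply/idP/eqP => [/set_mem[]//|pc].
  by apply/mem_set; split; rewrite //= in_itv /=; apply/andP.
have north : (2 <= #|` [fset p in X | p \in
    (`[x_lo Q, x_hi Q] `*` [set y_hi Q])%classic]|)%N <->
    (forall p, p \in X -> exists2 q, q \in X `\ p & p.2 <= q.2).
  apply: (two_maximizersP X _ snd (y_hi Q))
    => [p pX|p /inQ[]//|]; last exact: max_in.
  have [? ? ? ?] := inQ p pX; apply/idP/eqP => [/set_mem[]//|pc].
  by apply/mem_set; split; rewrite //= in_itv /=; apply/andP.
split=> [Xbetween A|Xedges p pX].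
  have halfplanes p pX := (between_halfplanesP X p).1 (Xbetween p pX).
  by move=> [[[->|->]|->]|->]; [apply/west|apply/east|apply/south|apply/north];
    move=> p /halfplanes[].
apply/between_halfplanesP; split.
- by apply: west.1 pX; apply: Xedges; do 3 left.
- by apply: east.1 pX; apply: Xedges; do 2 left; right.
- by apply: south.1 pX; apply: Xedges; left; right.
- by apply: north.1 pX; apply: Xedges; right.
Qed.
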